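(* For every $D\in\mathcal{C}$: (i) $\mathcal{T}^{2k}(D)=D^\uparrow$ for all integers $k\ge1$; (ii) $\mathcal{T}^{2k+1}(D)=\mathcal{T}(D)$ for all integers $k\ge1$; (iii) $\|\mathcal{T}(D)\|_{\partial_2,1}=\|D\|_{\partial_2,1}$; (iv) $\|\mathcal{T}^2(D)\|_{\partial_2,p}=\|D\|_{\partial_2,p}$ for all $p\ge1$.
   Context: $\mathcal{C}$ is the class of bivariate copulas; $\partial_2$ the partial derivative in the second argument; $\Pi(u,v)=uv$; the upper product is $D\vee E(u,v):=\int_0^1\min\{\partial_2D(u,t),\partial_2E(v,t)\}\,dt$; $\mathcal{T}(C):=C\vee\Pi$ and $\mathcal{T}^k$ is the $k$-fold composition. For measurable $h:(0,1)\to[0,1]$, $h^*$ is the a.e.-unique decreasing function with $\lambda(h^*\le y)=\lambda(h\le y)$ for all $y$; $D^\uparrow(v,u):=\int_0^uh_v^*(t)\,dt$ with $h_v=\partial_2D(v,\cdot)$. $\|C\|_{\partial_2,p}:=\left(\int_0^1\int_0^1|\partial_2C(u,v)|^p\,du\,dv\right)^{1/p}$. *)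

(* Defs.v *)
From HB Require Import structures.
From mathcomp Require Import all_boot all_order all_algebra.
From mathcomp Require Import all_classical all_reals all_analysis.
Set Implicit Arguments. Unset Strict Implicit. Unset Printing Implicit Defensive.
Import Order.TTheory GRing.Theory Num.Theory.
Import numFieldNormedType.Exports.
Local Open Scope classical_set_scope.
Local Open Scope ring_scope.

Section CopulaDefs.
Variable R : realType.
Local Notation mu := (@lebesgue_measure R).

(* A bivariate copula, represented as a function R -> R -> R of which only
   the restriction to [0,1]^2 is relevant. *)
Definition is_copula (C : R -> R -> R) : Prop :=
  (forall u, 0 <= u <= 1 -> [/\ C u 0 = 0, C 0 u = 0, C u 1 = u & C 1 u = u]) /\
  (forall u1 u2 v1 v2, 0 <= u1 -> u1 <= u2 -> u2 <= 1 ->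
      0 <= v1 -> v1 <= v2 -> v2 <= 1 ->
      0 <= C u2 v2 - C u2 v1 - C u1 v2 + C u1 v1).

Definition d2 (C : R -> R -> R) (u v : R) : R := derive1 (C u) v.

Definition Pi (u v : R) : R := u * v.

Definition upper_prod (D E : R -> R -> R) (u v : R) : R :=
  Rintegral mu `[0, 1] (fun t => Num.min (d2 D u t) (d2 E v t)).

Definition TT (C : R -> R -> R) : R -> R -> R := upper_prod C Pi.

(* decreasing rearrangement h^* of h : (0,1) -> [0,1]: some (a.e.-unique)
   nonincreasing function on (0,1) equimeasurable with h. *)
Definition is_decr_rearr (h g : R -> R) : Prop :=
  (forall x y, 0 < x -> x <= y -> y < 1 -> g y <= g x) /\
  (forall y, mu [set t | 0 < t < 1 /\ g t <= y] = mu [set t | 0 < t < 1 /\ h t <= y]).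

Definition decr_rearr (h : R -> R) : R -> R := xget (fun _ => 0) (is_decr_rearr h).

Definition Dup (D : R -> R -> R) (v u : R) : R :=
  Rintegral mu `[0, u] (decr_rearr (d2 D v)).

Definition norm_d2 (p : R) (C : R -> R -> R) : \bar R :=
  poweR (\int[mu]_(v in `[0%R, 1%R]) \int[mu]_(u in `[0%R, 1%R]) ((`|d2 C u v| `^ p)%:E))%E
        p^-1.

End CopulaDefs.

(* Main.v *)
Require Import Defs.
From HB Require Import structures.
From mathcomp Require Import all_boot all_order all_algebra.
From mathcomp Require Import all_classical all_reals all_analysis.
From mathcomp Require Import measurable_realfun.
From mathcomp Require Import lra.
Set Implicit Arguments. Unset Strict Implicit. Unset Printing Implicit Defensive.
Import Order.TTheory GRing.Theory Num.Theory.
Import numFieldNormedType.Exports.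
Local Open Scope classical_set_scope.
Local Open Scope ring_scope.

(** Write h_u for the section t |-> d2 D u t and G_u(s) for the measure of
    {t in (0,1) | h_u t > s}.  By the layer cake formula
    TT D u v = \int_0^1 min(h_u, v) = \int_0^v G_u, so the differentiation
    theorem gives d2 (TT D) u = G_u almost everywhere.  Replacing h_u by its
    tail G_u and applying the layer cake formula again, now to the decreasing
    rearrangement h_u^*, whose superlevel sets are intervals (0, G_u(s)),
    yields TT (TT D) u w = \int_0^1 min(G_u, w) = \int_0^w h_u^*.  Since h_u
    and h_u^* have the same tail, TT (TT (TT D)) = TT D.  The norm identities
    follow by Tonelli from \int_0^1 G_u = \int_0^1 h_u and from the
    equimeasurability of h_u and h_u^*.  No almost everywhere
    differentiability of copulas is needed, only that d2 D is jointly Borel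
    with values in [0,1]. *)

(** * Measurability of the derivative *)

Section DiffQuotient.
Variable R : realType.
Implicit Types (f : R -> R) (a h : R).

Definition dquo f a h : R := h^-1 * (f (h + a) - f a).

(** Candidate for the derivative at [a], taken along the increments [1/(n+1)]: a limsup of a
    sequence is measurable whether or not the derivative exists. *)
Definition dquo_limsup f a : R := limn_sup (fun n => dquo f a n.+1%:R^-1).

(** Differentiability phrased with countable quantifiers only (tolerances [1/(k+1)], radii
    [1/(n+1)], rational increments), so that it cuts out a Borel set. *)
Definition dquo_rat_cvg f a : Prop :=
  forall k : nat, exists n : nat, forall r : rat,
    (ratr r : R) != 0 -> `|ratr r : R| < n.+1%:R^-1 ->
    `|dquo f a (ratr r) - dquo_limsup f a| <= k.+1%:R^-1.

Lemma dquo_cvg_limsup f a l :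
  dquo f a h @[h --> 0^'] --> l -> dquo_limsup f a = l.
Proof.
move=> /cvgr_dnbhsP fl; apply: (cvg_limn_inf_sup _).2.
apply: (fl (fun n => n.+1%:R^-1)); split; last exact: cvg_harmonic.
by move=> n; rewrite invr_eq0 pnatr_eq0.
Qed.

(** The quotient is continuous in the increment away from 0. A bound that fails at a real increment
    therefore fails on a neighbourhood of it, hence at a rational one. *)
Lemma dquo_rat_cvgP f a : continuous f ->
  dquo_rat_cvg f a <-> dquo f a h @[h --> 0^'] --> dquo_limsup f a.
Proof.
move=> cf; split=> [H|fl k].
- apply/cvgrPdist_le => e e0.
  have [k ke] : exists k : nat, k.+1%:R^-1 < e.
    have /cvgrPdist_lt/(_ e e0)[k _ ke] := @cvg_harmonic R.
    exists k; have := ke k (leqnn k).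
    by rewrite sub0r normrN gtr0_norm// /harmonic/= invr_gt0 ltr0n.
  have [n Hn] := H k.
  near=> h.
  have h0 : h != 0 by near: h; exact: nbhs_dnbhs_neq.
  have hn : `|h| < n.+1%:R^-1.
    near: h; apply: dnbhs0_lt; rewrite invr_gt0 ltr0n//.
  rewrite distrC; apply: le_trans (ltW ke); rewrite leNgt; apply/negP => hk.
  have cq : {for h, continuous (dquo f a)}.
    apply: (@cvgM R _ (nbhs h)); first exact: cvgV.
    apply: (@cvgB R); last exact: cvg_cst.
    apply: (@cvg_comp _ _ _ (fun h => h + a) f).
      by apply: cvgD; [exact: cvg_id|exact: cvg_cst].
    exact: cf.
  have : \forall x \near h, [/\ x != 0, `|x| < n.+1%:R^-1 &
      k.+1%:R^-1 < `|dquo f a x - dquo_limsup f a|].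
    near=> x; split.
    - near: x; have := @cvg_id _ (nbhs h) => /cvgr_neq0; exact.
    - near: x; have /cvg_norm := @cvg_id _ (nbhs h).
      by move/cvgr_lt; exact.
    - near: x; have : `|dquo f a x - dquo_limsup f a| @[x --> h] -->
         `|dquo f a h - dquo_limsup f a|.
        by apply: cvg_norm; apply: cvgB => //; exact: cvg_cst.
      by move/cvgr_gt; exact.
  move=> [e' /= e'0 he'].
  have [r] := @rat_in_itvoo R (h - e') (h + e') ltac:(lra).
  rewrite in_itv/= => /andP[r1 r2].
  have [|r0 rn] := he' (ratr r).
    by rewrite /ball/= ltr_distlC; apply/andP.
  by rewrite ltNge Hn.
- have /cvgrPdist_le/(_ k.+1%:R^-1) := fl.
  rewrite invr_gt0 ltr0n => /(_ isT)[e /= e0 he].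
  have [n ne] : exists n : nat, n.+1%:R^-1 < e.
    have /cvgrPdist_lt/(_ e e0)[n _ ke] := @cvg_harmonic R.
    exists n; have := ke n (leqnn n).
    by rewrite sub0r normrN gtr0_norm// /harmonic/= invr_gt0 ltr0n.
  exists n => r r0 rn; rewrite distrC; apply: he => //=.
  by rewrite sub0r normrN (lt_trans rn).
Unshelve. all: by end_near. Qed.

(* Where the derivative does not exist, [derive1] takes the junk value [0]. *)
Lemma derive1_dquoE f a : continuous f ->
  derive1 f a = if `[< dquo_rat_cvg f a >] then dquo_limsup f a else 0.
Proof.
move=> cf; case: ifPn => /asboolP fa.
  by apply/cvg_lim => //; exact/dquo_rat_cvgP.
apply: dvgP => /cvg_ex[l fl]; apply: fa; apply/dquo_rat_cvgP => //.
by rewrite (dquo_cvg_limsup fl).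
Qed.

End DiffQuotient.

(** * Constant extension beyond the unit square *)

Section Clamp.
Variable R : realType.
Implicit Types x y : R.

Definition clamp01 x : R := Num.max 0 (Num.min 1 x).

Lemma clamp01_itv x : 0 <= clamp01 x <= 1.
Proof. by rewrite /clamp01 /Num.max /Num.min; do 2?case: ifPn; lra. Qed.

Lemma clamp01_id x : 0 <= x <= 1 -> clamp01 x = x.
Proof. by rewrite /clamp01 /Num.max /Num.min; do 2?case: ifPn; lra. Qed.

Lemma clamp01_lip x y : x <= y -> 0 <= clamp01 y - clamp01 x <= y - x.
Proof. by rewrite /clamp01 /Num.max /Num.min; do 4?case: ifPn; lra. Qed.

Lemma measurable_clamp01 : measurable_fun setT clamp01.
Proof.
apply: nondecreasing_measurable => // x y /clamp01_lip; lra.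
Qed.

End Clamp.

Section Regular.
Variable R : realType.
Local Notation mu := (@lebesgue_measure R).
Implicit Types (C : R -> R -> R) (u v w : R) (p : R * R).

(* Unlike the copula axioms, these properties are readily seen to be
   preserved by [TT]. *)
Definition regular C : Prop :=
  (forall u v w, 0 <= u <= 1 -> 0 <= v -> v <= w -> w <= 1 ->
     0 <= C u w - C u v <= w - v) /\
  (forall v, 0 <= v <= 1 -> measurable_fun (`[0, 1] : set R) (C ^~ v)).

Lemma copula_regular C : is_copula C -> regular C.
Proof.
move=> [bd inc]; split=> [u v w u01 v0 vw w1|v v01].
  have [|_ C0v _ C1v] := bd v; first by lra.
  have [|_ C0w _ C1w] := bd w; first by lra.
  (* The rectangle [[0,u] x [v,w]] gives the lower bound, [[u,1] x [v,w]] the upper one. *)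
  have := inc 0 u v w; have := inc u 1 v w; lra.
have -> : measurable_fun (`[0, 1] : set R) (C ^~ v) =
          measurable_fun (`[0, 1] : set R) (fun u => C (clamp01 u) v).
  apply: propext; split; apply: eq_measurable_fun => u;
    by rewrite inE/= in_itv/= => u01; rewrite clamp01_id.
apply: nondecreasing_measurable => // x y /clamp01_lip xy.
have := clamp01_itv x; have := clamp01_itv y.
move=> y01 x01; have [Cx0 _ _ _] := bd _ x01; have [Cy0 _ _ _] := bd _ y01.
by have := inc (clamp01 x) (clamp01 y) 0 v; lra.
Qed.

(** The values of [C] off the unit square are arbitrary; freezing them at the edges makes every
    section monotone and 1-Lipschitz on the whole line. *)
Definition extend C u v : R := C (clamp01 u) (clamp01 v).

Lemma extend_lip C u v w : regular C -> v <= w ->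
  0 <= extend C u w - extend C u v <= w - v.
Proof.
move=> [Clip _] vw; have := clamp01_lip vw.
have := clamp01_itv v; have := clamp01_itv w => cw cv vw'.
have := Clip (clamp01 u) (clamp01 v) (clamp01 w) (clamp01_itv u).
by rewrite /extend; lra.
Qed.

Lemma extend_lipN C u v w : regular C ->
  `|extend C u w - extend C u v| <= `|w - v|.
Proof.
move=> rC; have [vw|/ltW wv] := leP v w.
  by have := extend_lip u rC vw => ?; rewrite !ger0_norm; lra.
by have := extend_lip u rC wv => ?; rewrite !ler0_norm; lra.
Qed.

Lemma continuous_extend C u : regular C -> continuous (extend C u).
Proof.
move=> rC v; apply/cvgrPdist_le => e e0.
have /cvgrPdist_le/(_ e e0) := @cvg_id _ (nbhs v).
by apply: filterS => w /=; apply: le_trans; exact: extend_lipN.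
Qed.

Lemma measurable_extend C : regular C ->
  measurable_fun setT (fun p => extend C p.1 p.2).
Proof.
move=> rC; apply: (measurability (@RGenOInfty.G R)) => [|/= _ [_] [a] -> <-].
  exact: RGenOInfty.measurableE.
(* As [extend C u] is nondecreasing and continuous, it exceeds [a] at [v] iff
   it does so at some rational [q <= v]. *)
rewrite setTI [X in measurable X](_ : _ = \bigcup_(q : rat)
    ([set u | a < extend C u (ratr q)] `*` (`[ratr q, +oo[ : set R))).
  apply: bigcupT_measurable_rat => q; apply: measurableX => //.
  have : measurable_fun setT (fun u => a < extend C u (ratr q)).
    apply: measurable_fun_ltr => //.
    apply: (@measurable_comp _ _ _ _ _ _ (`[0, 1]%classic : set R) (C ^~ _)) => //.
    - by move=> _ [x _ <-] /=; rewrite in_itv/= clamp01_itv.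
    - exact: (proj2 rC _ (clamp01_itv _)).
    - exact: measurable_clamp01.
  move=> /(_ measurableT [set true]); rewrite setTI; exact.
apply/seteqP; split => [[u v]|[u v] [q _]]/=; rewrite !in_itv/= !andbT.
  move=> auv.
  have : \forall w \near v, a < extend C u w.
    by have := @continuous_extend C u rC v => /cvgr_gt; exact.
  move=> [e /= e0 he].
  have [q] := @rat_in_itvoo R (v - e) v ltac:(lra).
  rewrite in_itv/= => /andP[r1 r2].
  exists q => //=; rewrite in_itv/= andbT (ltW r2); split=> //.
  by apply: he; rewrite /ball/= ltr_distlC; lra.
move=> [auq qv]; have := extend_lip u rC qv; lra.
Qed.

Lemma dquo_extend_itv C u v h : regular C ->  h != 0 ->
  0 <= dquo (extend C u) v h <= 1.
Proof.
move=> rC h0; rewrite /dquo mulrC.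
have [h_gt0|h_lt0] : 0 < h \/ h < 0 by move: h0; rewrite neq_lt => /orP[|]; lra.
  have := @extend_lip C u v (h + v) rC ltac:(lra).
  by rewrite ler_pdivlMr// ler_pdivrMr//; lra.
have := @extend_lip C u (h + v) v rC ltac:(lra).
by rewrite ler_ndivlMr// ler_ndivrMr//; lra.
Qed.

Lemma measurable_dquo_extend C h : regular C ->
  measurable_fun setT (fun p => dquo (extend C p.1) p.2 h).
Proof.
move=> rC; apply: measurable_funM => //; apply: measurable_funB.
  apply: (@measurableT_comp _ _ _ _ _ _ (fun p => extend C p.1 p.2) _
    (fun p => (p.1, h + p.2))); first exact: measurable_extend.
  by apply: measurable_fun_pair => //; apply: measurable_funD.
exact: measurable_extend.
Qed.

Lemma measurable_dquo_limsup_extend C : regular C ->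
  measurable_fun setT (fun p => dquo_limsup (extend C p.1) p.2).
Proof.
move=> rC; apply: measurable_fun_limn_sup.
- move=> p _; exists 1 => _ [n _ <-].
  by have /andP[] := @dquo_extend_itv C p.1 p.2 n.+1%:R^-1 rC
    ltac:(by rewrite invr_eq0 pnatr_eq0).
- move=> p _; exists 0 => _ [n _ <-].
  by have /andP[] := @dquo_extend_itv C p.1 p.2 n.+1%:R^-1 rC
    ltac:(by rewrite invr_eq0 pnatr_eq0).
- by move=> n; exact: measurable_dquo_extend.
Qed.

Lemma measurable_dquo_rat_cvg C : regular C ->
  measurable [set p | dquo_rat_cvg (extend C p.1) p.2].
Proof.
move=> rC; rewrite [X in measurable X](_ : _ =
  \bigcap_(k : nat) \bigcup_(n : nat) ~` \bigcup_(r : rat)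
   [set p | ((ratr r : R) != 0) && (`|ratr r : R| < n.+1%:R^-1) &&
     (k.+1%:R^-1 <
       `|dquo (extend C p.1) p.2 (ratr r) - dquo_limsup (extend C p.1) p.2|)]).
  apply: bigcapT_measurable => k; apply: bigcupT_measurable => n.
  apply: measurableC; apply: bigcupT_measurable_rat => r.
  (* The conditions on [r] do not involve [p], so the set is either empty or given by the last
     inequality alone. *)
  case: (_ && (_ < _)) => /=; last first.
    by rewrite [X in measurable X](_ : _ = set0)//; apply/seteqP; split.
  have : measurable_fun setT (fun p : R * R => k.+1%:R^-1 <
     `|dquo (extend C p.1) p.2 (ratr r) - dquo_limsup (extend C p.1) p.2|).
    apply: measurable_fun_ltr => //.
    apply: measurableT_comp => //; apply: measurable_funB.
      exact: measurable_dquo_extend.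
    exact: measurable_dquo_limsup_extend.
  by move=> /(_ measurableT [set true]); rewrite setTI; exact.
apply/seteqP; split => [p H k _|p H k].
  have [n Hn] := H k; exists n => // -[r _ /= /andP[/andP[r0 rn]]].
  by rewrite ltNge Hn.
have [n _ Hn] := H k I; exists n => r r0 rn.
rewrite leNgt; apply/negP => rk; apply: Hn; exists r => //=.
by rewrite r0 rn.
Qed.

(** The second coordinate is confined to the open interval because at 0 and 1 the two-sided
    derivative depends on values of [C] outside the square. *)
Definition d2z C p : R :=
  if (0 <= p.1 <= 1) && (0 < p.2 < 1) then d2 C p.1 p.2 else 0.

Lemma d2_extend C u v : 0 <= u <= 1 -> 0 < v < 1 ->
  d2 C u v = derive1 (extend C u) v.
Proof.
move=> u01 v01; rewrite /d2; rewrite !derive1E; apply: near_eq_derive.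
  near=> w; rewrite /extend !clamp01_id//.
  have : w \in `]0, 1[ by near: w; apply: near_in_itvoo; rewrite in_itv.
  by rewrite in_itv/=; lra.
Unshelve. all: by end_near. Qed.

Lemma d2zE C p : regular C -> d2z C p =
  if (0 <= p.1 <= 1) && (0 < p.2 < 1) && `[< dquo_rat_cvg (extend C p.1) p.2 >]
  then dquo_limsup (extend C p.1) p.2 else 0.
Proof.
move=> rC; rewrite /d2z; case: ifPn => //= /andP[p1 p2].
by rewrite d2_extend// derive1_dquoE//; exact: continuous_extend.
Qed.

Lemma measurable_d2z C : regular C -> measurable_fun setT (d2z C).
Proof.
move=> rC; have -> : d2z C = fun p => if (0 <= p.1 <= 1) && (0 < p.2 < 1) &&
    `[< dquo_rat_cvg (extend C p.1) p.2 >]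
  then dquo_limsup (extend C p.1) p.2 else 0.
  by apply/funext => p; rewrite d2zE.
apply: measurable_fun_ifT => //; last exact: measurable_dquo_limsup_extend.
apply: measurable_and.
  apply: measurable_and; apply: measurable_and.
  - exact: measurable_fun_ler.
  - exact: measurable_fun_ler.
  - exact: measurable_fun_ltr.
  - exact: measurable_fun_ltr.
apply: (measurable_fun_bool true); rewrite setTI.
rewrite [X in measurable X](_ : _ =
  [set p | dquo_rat_cvg (extend C p.1) p.2]); first exact: measurable_dquo_rat_cvg.
by apply/seteqP; split => p /= /asboolP.
Qed.

Lemma d2z_itv C p : regular C -> 0 <= d2z C p <= 1.
Proof.
move=> rC; rewrite d2zE//; case: ifPn => [/andP[_ /asboolP H]|_]; last lra.
have /dquo_rat_cvgP := H; move=> /(_ (@continuous_extend C _ rC)) fl.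
apply/andP; split.
  apply: (cvgr_to_ge fl); near=> h.
  have h0 : h != 0 by near: h; exact: nbhs_dnbhs_neq.
  by have /andP[] := @dquo_extend_itv C p.1 p.2 h rC h0.
apply: (cvgr_to_le fl); near=> h.
have h0 : h != 0 by near: h; exact: nbhs_dnbhs_neq.
by have /andP[] := @dquo_extend_itv C p.1 p.2 h rC h0.
Unshelve. all: by end_near. Qed.

End Regular.

(** * Layer cake formula and differentiation *)

Section LayerCake.
Variable R : realType.
Local Notation mu := (@lebesgue_measure R).
Local Notation I01 := (`]0, 1[%classic : set R).
Implicit Types (f g h : R -> R) (A : set R).

(** Tonelli for the region [S] under the graph of [f]: the section at [x] is the interval from 0 to
    [f x], the section at [t] is a superlevel set, and it is empty for [t] outside [(0,1)] since
    [f <= 1]. *)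
Lemma layer_cake A f : measurable A -> measurable_fun A f ->
  (forall x, A x -> 0 <= f x <= 1) ->
  (\int[mu]_(x in A) (f x)%:E =
   \int[mu]_(t in I01) mu (A `&` [set x | (t < f x)%R]))%E.
Proof.
move=> mA mf f01; pose fA := f \_ A.
have fAE x : fA x = if x \in A then f x else 0 by rewrite /fA patchE.
have mfA : measurable_fun setT fA by move/(measurable_restrictT _ mA): mf.
pose S := [set p : R * R | 0 < p.2 < fA p.1].
have mS : measurable S.
  have : measurable_fun setT (fun p : R * R => 0 < p.2 < fA p.1).
    apply: measurable_and; apply: measurable_fun_ltr => //.
    exact: measurableT_comp.
  by move=> /(_ measurableT [set true]); rewrite setTI; exact.
rewrite integral_mkcond [RHS]integral_mkcond/=.
have := @indic_fubini_tonelli _ _ _ _ R mu mu S mS.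
rewrite indic_fubini_tonelli_FE// indic_fubini_tonelli_GE//.
set a := (X in X = _ -> _); set b := (X in _ = X -> _) => ab.
transitivity a; [|rewrite ab]; apply: eq_integral => x _ /=.
- rewrite (_ : xsection S x = `]0, fA x[%classic); last first.
    by apply/seteqP; split=> t; rewrite /xsection/= inE/= in_itv.
  rewrite lebesgue_measure_itv/= lte_fin patchE fAE.
  case: ifPn => [/set_mem/f01|]; last by rewrite ltxx.
  case: ifPn => [_ _|]; first by rewrite sube0.
  by move=> ? ?; congr EFin; lra.
- rewrite patchE; case: ifPn => xI.
    congr (mu _); apply/seteqP; split=> t; rewrite /ysection/= inE/=.
      rewrite /S/= fAE; case: ifPn => [/set_mem|_]; last by lra.
      by move=> At /andP[_].
    move=> [At xt]; rewrite /S/= fAE mem_set// xt andbT.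
    by move: xI; rewrite inE/= in_itv/= => /andP[].
  rewrite (_ : ysection S x = set0) ?measure0//.
  apply/seteqP; split=> t //; rewrite /ysection/= inE /S/=.
  move=> /andP[x0 xf]; move/negP: xI; apply; rewrite inE/= in_itv/= x0/=.
  move: xf; rewrite fAE; case: ifPn => [/set_mem/f01|_]; lra.
Qed.

Lemma integrable_unit A f : measurable A -> (mu A < +oo)%E ->
  measurable_fun A f -> (forall x, A x -> 0 <= f x <= 1) ->
  mu.-integrable A (EFin \o f).
Proof.
move=> mA Aoo mf f01; apply: measurable_bounded_integrable => //.
exists 1; split; first exact: num_real.
by move=> x x1 t /= /f01 ?; rewrite ger0_norm; lra.
Qed.

(** Extending [g] by zero makes it integrable on the line, so [FTC1] applies; differentiation is
    local, so it is enough that [F] is the integral on the unit interval. *)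
Lemma derive1_Rintegral_ae g (F : R -> R) : measurable_fun I01 g ->
  (forall x, 0 < x < 1 -> 0 <= g x <= 1) ->
  (forall x, 0 <= x <= 1 -> F x = \int[mu]_(t in `]0, x]) g t) ->
  {ae mu, forall x, 0 < x < 1 -> derive1 F x = g x}.
Proof.
move=> mg g01 FE; pose f := g \_ I01.
have fE x : f x = if x \in I01 then g x else 0 by rewrite /f patchE.
have mf : measurable_fun setT f by move/(measurable_restrictT _ _): mg; exact.
have f01 x : 0 <= f x <= 1.
  rewrite fE; case: ifPn => [|_]; last lra.
  by rewrite inE/= in_itv/= => /g01.
have fi A : measurable A -> (mu A < +oo)%E -> mu.-integrable A (EFin \o f).
  by move=> mA Aoo; apply: integrable_unit => //; exact: measurable_funS mf.
have fiy y : mu.-integrable [set` Interval (BRight 0) (BRight y)] (EFin \o f).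
  apply: fi => //; rewrite lebesgue_measure_itv/=.
  by case: ifPn => // _; rewrite ltry.
have locf : locally_integrable setT f.
  apply: integrable_locally => //; apply: integrable_unit => //.
  by rewrite lebesgue_measure_itv/= lte01 sube0 ltry.
have := FTC1 fiy locf; apply: filterS.
  exact: (ae_filter_ringOfSetsType mu).
move=> x /= + x01.
case => [|dG Gx]; first by rewrite lte_fin; lra.
have -> : g x = f x by rewrite fE mem_set//= in_itv.
rewrite -Gx !derive1E; apply: near_eq_derive; near=> y.
have y01 : 0 < y < 1.
  have : y \in `]0, 1[ by near: y; apply: near_in_itvoo; rewrite in_itv.
  by rewrite in_itv.
rewrite FE; last lra.
apply: eq_Rintegral => t; rewrite inE/= in_itv/= => t0y.
by rewrite fE mem_set//= in_itv/=; lra.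
Unshelve. all: by end_near. Qed.
End LayerCake.

(** * Tails and decreasing rearrangements *)

Section Rearrangement.
Variable R : realType.
Local Notation mu := (@lebesgue_measure R).
Local Notation I01 := (`]0, 1[%classic : set R).
Implicit Types (f g h : R -> R) (t s x y w : R).

Definition unit_fun h : Prop :=
  measurable_fun I01 h /\ (forall x, 0 < x < 1 -> 0 <= h x <= 1).

Definition superlevel h t : set R := I01 `&` [set x | t < h x].

Definition tail h t : R := fine (mu (superlevel h t)).

Lemma le_lebesgue (A B : set R) : measurable A -> measurable B ->
  A `<=` B -> (mu A <= mu B)%E.
Proof. by move=> mA mB AB; rewrite le_measure ?inE. Qed.

Lemma lebesgue_I01 : mu I01 = 1%E.
Proof. by rewrite lebesgue_measure_itv/= lte01 sube0. Qed.

Lemma measurable_superlevel h t : measurable_fun I01 h ->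
  measurable (superlevel h t).
Proof.
move=> mh; rewrite /superlevel.
rewrite (_ : [set x | t < h x] = h @^-1` `]t, +oo[%classic); first exact: mh.
by apply/seteqP; split => x /=; rewrite in_itv/= andbT.
Qed.

Lemma tailE h t : measurable_fun I01 h -> mu (superlevel h t) = (tail h t)%:E.
Proof.
move=> mh; rewrite fineK// ge0_fin_numE// (@le_lt_trans _ _ (mu I01))//.
  apply: le_lebesgue => //; last exact: subIsetl.
  exact: measurable_superlevel.
by rewrite lebesgue_I01 ltry.
Qed.

Lemma tail_itv h t : measurable_fun I01 h -> 0 <= tail h t <= 1.
Proof.
move=> mh; rewrite -!lee_fin -tailE// measure_ge0 -lebesgue_I01.
apply: le_lebesgue => //; last exact: subIsetl.
exact: measurable_superlevel.
Qed.

Lemma tail_nincr h s t : measurable_fun I01 h -> s <= t -> tail h t <= tail h s.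
Proof.
move=> mh st; rewrite -lee_fin -!tailE// le_lebesgue//;
  try exact: measurable_superlevel.
by move=> x [Ix] /=; move=> tx; split=> //=; exact: le_lt_trans tx.
Qed.

Lemma unit_fun_tail h : measurable_fun I01 h -> unit_fun (tail h).
Proof.
move=> mh; split=> [|x _]; last exact: tail_itv.
by apply: nonincreasing_measurable => // x y; exact: tail_nincr.
Qed.

Lemma tail_ge1 h t : unit_fun h -> 1 <= t -> tail h t = 0.
Proof.
move=> [_ h01] t1; rewrite /tail (_ : superlevel h t = set0) ?measure0//.
by apply/seteqP; split=> // x []/=; rewrite in_itv/= => /h01; lra.
Qed.

(** The superlevel set at [t] is the increasing union of those at [t + 1/(n+1)], so continuity from
    below applies. *)
Lemma tail_right_cont h s t : measurable_fun I01 h -> s < tail h t ->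
  exists2 e, 0 < e & s < tail h (t + e).
Proof.
move=> mh st.
pose A n := superlevel h (t + n.+1%:R^-1).
have mA n : measurable (A n) by exact: measurable_superlevel.
have UA : \bigcup_n A n = superlevel h t.
  apply/seteqP; split => x.
    move=> [n _ [Ix /= tx]]; split=> //=; apply: lt_trans tx.
    by rewrite ltrDl invr_gt0 ltr0n.
  move=> [Ix /= tx]; have /cvgrPdist_lt := @cvg_harmonic R.
  move=> /(_ (h x - t)); rewrite subr_gt0 => /(_ tx)[n _ Hn].
  exists n => //; split=> //=.
  have := Hn n (leqnn n); rewrite sub0r normrN gtr0_norm /harmonic/=; last first.
    by rewrite invr_gt0 ltr0n.
  by rewrite ltrBrDl.
have ndA : nondecreasing_seq A.
  move=> m n mn; apply/subsetPset => x [Ix /= tx]; split=> //=.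
  apply: le_lt_trans tx; rewrite lerD2l lef_pV2 ?posrE ?ltr0n// ler_nat ltnS//.
have cvgA : mu (A n) @[n --> \oo] --> (tail h t)%:E.
  rewrite -tailE// -UA; apply: nondecreasing_cvg_mu => //.
  exact: bigcupT_measurable.
have : \forall n \near \oo, (s%:E < mu (A n))%E.
  have /fine_cvgP[_ cA] := cvgA.
  have := cA => /cvgr_gt/(_ _ st); apply: filterS => n /=.
  by rewrite tailE//= lte_fin.
move=> [n _ /(_ n (leqnn n))]; rewrite tailE// lte_fin => sn.
by exists n.+1%:R^-1 => //; rewrite invr_gt0 ltr0n.
Qed.

(** Translates the sublevel sets used by [is_decr_rearr] into tails: equimeasurable functions are
    those with equal tails. *)
Lemma measure_sublevel h y : measurable_fun I01 h ->
  mu [set t | 0 < t < 1 /\ h t <= y] = (1 - tail h y)%:E.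
Proof.
move=> mh; rewrite (_ : [set t | _] = I01 `\` superlevel h y); last first.
  apply/seteqP; split => t /=; rewrite /superlevel in_itv/=.
    by move=> [t01 hy]; split=> // -[_] /=; rewrite ltNge hy.
  move=> [t01 H]; split=> //; rewrite leNgt; apply/negP => yt; apply: H.
  by split => //=; rewrite in_itv.
have mS := measurable_superlevel y mh.
have I1 : (mu I01 < +oo)%E by rewrite lebesgue_I01 ltry.
rewrite measureD// setIidr; last exact: subIsetl.
by rewrite EFinB -tailE// -lebesgue_I01.
Qed.

Definition decr_on_unit g : Prop :=
  forall x y, 0 < x -> x <= y -> y < 1 -> g y <= g x.

Lemma decr_on_unit_measurable g : decr_on_unit g -> measurable_fun I01 g.
Proof.
move=> dg; apply: (measurability (@RGenOInfty.G R)) => [|/= _ [_] [a] -> <-].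
  exact: RGenOInfty.measurableE.
(* Superlevel sets of a monotone function are intervals. *)
apply: is_interval_measurable => s t /= [+ +] [+ +] u /andP[].
rewrite !in_itv/= !andbT => s01 as_ t01 at_ su ut; split; first by lra.
by apply: lt_le_trans at_ _; apply: dg; lra.
Qed.

(** Superlevel sets of [g] are initial segments of [(0,1)]. Either [g] exceeds [t] on all of
    [(0,w)], or some [y < w] has [g y <= t] and the whole superlevel set lies below [y]. *)
Lemma measure_decr_superlevel g w t : decr_on_unit g -> 0 < w -> w <= 1 ->
  mu (`]0, w[ `&` [set x | t < g x]) = (Num.min (tail g t) w)%:E.
Proof.
move=> dg w0 w1; have mg := decr_on_unit_measurable dg.
have [sub|/existsNP[y /not_implyP[]]] :=
    pselect (forall x, 0 < x < w -> t < g x).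
  rewrite (_ : _ `&` _ = `]0, w[%classic); last first.
    apply/seteqP; split => [x []//|x xw]; split=> //.
    by apply: sub; move: xw; rewrite /= in_itv.
  rewrite lebesgue_measure_itv/= lte_fin w0 sube0 min_r//.
  have : (mu `]0%R, w[ <= mu (superlevel g t))%E.
    apply: le_lebesgue => //; first exact: measurable_superlevel.
    move=> x /=; rewrite in_itv/= => xw; split=> /=; last exact: sub.
    by rewrite in_itv/=; lra.
  by rewrite lebesgue_measure_itv/= lte_fin w0 sube0 tailE// lee_fin.
move=> yw /negP; rewrite -leNgt => gy.
have ly x : 0 < x < 1 -> t < g x -> x < y.
  move=> x01 tx; rewrite ltNge; apply/negP => yx.
  by have := dg y x; lra.
have -> : `]0, w[ `&` [set x | t < g x] = superlevel g t.
  apply/seteqP; split => x [] /=; rewrite in_itv/= => x0 tx.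
    by split=> //=; rewrite in_itv/=; lra.
  by split=> //=; rewrite in_itv/=; have := ly x x0 tx; lra.
rewrite tailE// min_l//.
have : (mu (superlevel g t) <= mu `]0%R, y[)%E.
  apply: le_lebesgue => //; first exact: measurable_superlevel.
  move=> x [/=]; rewrite !in_itv/= => x0 tx; have := ly x x0 tx; lra.
rewrite lebesgue_measure_itv/= lte_fin; have -> : 0 < y by lra.
by rewrite sube0 tailE// lee_fin; lra.
Qed.

Section DecrRearr.
Variables (h : R -> R).
Hypothesis uh : unit_fun h.

Let mh : measurable_fun I01 h := proj1 uh.

Lemma tail_decr_rearr g t : is_decr_rearr h g -> tail g t = tail h t.
Proof.
move=> [dg eg]; have mg := decr_on_unit_measurable dg.
have := eg t; rewrite !measure_sublevel// => -[]; lra.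
Qed.

(** Monotonicity turns the almost everywhere bounds into pointwise ones. If [g x < 0], the set where
    [g] exceeds [g x] lies in [(0,x)], although its measure must be 1. If [g x > 1], then [g > 1] on
    [(0,x)], although the tail at 1 vanishes. *)
Lemma unit_fun_decr_rearr g : is_decr_rearr h g -> unit_fun g.
Proof.
move=> rg; have [dg _] := rg; have mg := decr_on_unit_measurable dg.
split=> // x x01; apply/andP; split; rewrite leNgt; apply/negP => gx.
- have tg1 : tail g (g x) = 1.
    rewrite (tail_decr_rearr _ rg) /tail (_ : superlevel h _ = I01).
      by rewrite lebesgue_I01.
    apply/seteqP; split => [y []//|y Iy]; split=> //=.
    by move: Iy => /=; rewrite in_itv/= => /(proj2 uh); lra.
  have := @measure_decr_superlevel g 1 (g x) dg ltr01 (lexx _).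
  rewrite tg1.
  have : (mu (`]0%R, 1%R[ `&` [set x0 | (g x < g x0)%R]) <= mu `]0%R, x[)%E.
    apply: le_lebesgue => //; first exact: measurable_superlevel.
    move=> y [/=]; rewrite !in_itv/= => y0 gy.
    have := dg x y; have [//|xy] := ltP y x; lra.
  rewrite lebesgue_measure_itv/= lte_fin; have -> : 0 < x by lra.
  by rewrite sube0 => + e; rewrite e lee_fin min_l//; lra.
- have : (mu `]0%R, x[ <= mu (superlevel g 1))%E.
    apply: le_lebesgue => //; first exact: measurable_superlevel.
    move=> y /=; rewrite in_itv/= => yx; split=> /=; first by rewrite in_itv/=; lra.
    by have := dg y x; lra.
  rewrite lebesgue_measure_itv/= lte_fin; have -> : 0 < x by lra.
  by rewrite sube0 tailE// (tail_decr_rearr _ rg) tail_ge1// lee_fin; lra.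
Qed.

(* [tail h] is a generalised inverse of the rearrangement of [h], and the tail
   of a nonincreasing function is again its generalised inverse. *)
Lemma is_decr_rearr_tail_tail : is_decr_rearr h (tail (tail h)).
Proof.
have [mt t01] := unit_fun_tail mh.
split=> [x y _ xy _|y]; first exact: tail_nincr.
have [mtt tt01] := unit_fun_tail mt.
rewrite !measure_sublevel//; congr (_ - _)%:E.
have [y0|y0] := ltP y 0.
  rewrite /tail (_ : superlevel h y = I01); last first.
    apply/seteqP; split => [x []//|x Ix]; split=> //=.
    by move: Ix => /=; rewrite in_itv/= => /(proj2 uh); lra.
  rewrite (_ : superlevel _ y = I01)//.
  apply/seteqP; split => [x []//|x Ix]; split=> //=.
  by move: Ix => /=; rewrite in_itv/= => /tt01; rewrite /tail; lra.
have [y1|y1] := leP 1 y; first by rewrite !tail_ge1//; exact: unit_fun_tail.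
rewrite /tail -/(tail h y).
have -> : superlevel (tail (tail h)) y = `]0, tail h y[%classic.
  have ty := tail_itv y mh.
  apply/seteqP; split => s.
    move=> [/=]; rewrite !in_itv/= => s01 ys; rewrite (andP s01).1/= ltNge.
    apply/negP => hs.
    (* If [tail h y <= s], monotonicity keeps the superlevel set of [tail h] at [s] inside [(0,y]],
       so the double tail at [s] is at most [y]. *)
    have : (mu (superlevel (tail h) s) <= mu `]0%R, y])%E.
      apply: le_lebesgue => //; first exact: measurable_superlevel.
      move=> x [/=]; rewrite !in_itv/= => x01 sx; rewrite (andP x01).1/= leNgt.
      by apply/negP => yx; have := tail_nincr mh (ltW yx); lra.
    rewrite lebesgue_measure_itv/= lte_fin tailE//; case: ifPn => _.
      by rewrite sube0 lee_fin; lra.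
    by rewrite lee_fin; lra.
  rewrite /= in_itv/= => sy; split=> /=; first by rewrite in_itv/=; lra.
  (* Monotonicity alone would only bound the double tail below by [y]; right continuity gains the
     margin [e] for the strict inequality. *)
  have [e e0 se] := tail_right_cont mh (andP sy).2.
  have ye1 : y + e < 1.
    rewrite ltNge; apply/negP => ye; have := tail_ge1 uh ye; lra.
  have : (mu `]0%R, (y + e)%R[ <= mu (superlevel (tail h) s))%E.
    apply: le_lebesgue => //; first exact: measurable_superlevel.
    move=> x /=; rewrite !in_itv/= => x0; split=> /=; first by rewrite in_itv/=; lra.
    by have := @tail_nincr h x (y + e) mh; lra.
  rewrite lebesgue_measure_itv/= lte_fin; have -> : 0 < y + e by lra.
  by rewrite sube0 tailE// lee_fin; lra.
rewrite lebesgue_measure_itv/= lte_fin; case: ifPn => [_|]; first by rewrite sube0.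
by rewrite -leNgt => h0; have := tail_itv y mh; move=> /andP[? _] /=; lra.
Qed.

Lemma decr_rearrP : is_decr_rearr h (decr_rearr h).
Proof.
apply: (xgetPex (fun=> 0)); exists (tail (tail h)).
exact: is_decr_rearr_tail_tail.
Qed.

End DecrRearr.

End Rearrangement.

(** * Upper product with the independence copula *)

Section UpperProduct.
Variable R : realType.
Local Notation mu := (@lebesgue_measure R).
Local Notation I01 := (`]0, 1[%classic : set R).
Implicit Types (C : R -> R -> R) (h g : R -> R) (p u v w t : R).

Lemma d2_Pi v t : d2 (@Pi R) v t = v.
Proof.
rewrite /d2 (_ : Pi v = fun x => x * v); last first.
  by apply/funext => x; rewrite /Pi mulrC.
by rewrite (@derive1Mr R id)// derive1_id mul1r.
Qed.

(** In the layer cake formula for [min(h, w)], the superlevel set at [t] is that of [h] when [t < w]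
    and empty when [w <= t]. *)
Lemma Rintegral_tail_min h w : unit_fun h -> 0 <= w <= 1 ->
  \int[mu]_(t in I01) Num.min (h t) w = \int[mu]_(t in `]0, w]) tail h t.
Proof.
move=> [mh h01] w01.
have mm : measurable_fun I01 (fun t => Num.min (h t) w).
  exact: measurable_minr.
have m01 x : I01 x -> 0 <= Num.min (h x) w <= 1.
  by rewrite /= in_itv/= => /h01; rewrite /Num.min; case: ifPn; lra.
have [mt t01] := unit_fun_tail mh.
have mtw : measurable_fun (`]0, w[ : set R) (EFin \o tail h).
  apply/measurable_EFinP; apply: measurable_funS mt => // x /=.
  by rewrite !in_itv/=; lra.
rewrite /Rintegral layer_cake//; congr fine.
rewrite -integral_itv_bndo_bndc// [LHS]integral_mkcond [RHS]integral_mkcond.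
apply: eq_integral => t _; rewrite !patchE.
case: ifPn => [|tI]; last first.
  case: ifPn => //; rewrite inE/= in_itv/= => tw.
  by case/negP: tI; rewrite inE/= in_itv/=; lra.
rewrite inE/= in_itv/= => tI.
case: ifPn => [|].
  rewrite inE/= in_itv/= => tw; rewrite -tailE//.
  congr (mu _); apply/seteqP; split=> x [Ix] /=; rewrite ?lt_min.
    by move=> /andP[tx _]; split.
  by move=> tx; split=> //; rewrite tx; lra.
move=> /negP tw; have wt : w <= t.
  by rewrite leNgt; apply/negP => wt; apply: tw; rewrite inE/= in_itv/=; lra.
rewrite [X in mu X](_ : _ = set0) ?measure0//.
by apply/seteqP; split=> x // [Ix] /=; rewrite lt_min [t < w]ltNge wt andbF.
Qed.

(** Layer cake for [g] on [(0,w)]: its superlevel sets there have measure [min(tail g t, w)] by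
    monotonicity, and [g] has the tail of [h]. *)
Lemma Rintegral_min_tail h g w : unit_fun h -> is_decr_rearr h g ->
  0 <= w <= 1 ->
  \int[mu]_(t in I01) Num.min (tail h t) w = \int[mu]_(t in `]0, w]) g t.
Proof.
move=> uh rg w01; have [mg g01] := unit_fun_decr_rearr uh rg.
(* [measure_decr_superlevel] requires [w > 0]; at [w = 0] both sides vanish. *)
have [->|w0] := eqVneq w 0.
  have -> : `]0, 0]%classic = set0 :> set R by rewrite set_itv_ge ?bnd_simp ?ltxx.
  rewrite Rintegral_set0 (@eq_Rintegral _ _ _ _ _ (cst 0)).
    by rewrite Rintegral_cst// mul0r.
  by move=> t _; rewrite /cst /= min_r//; have := tail_itv t uh.1; lra.
have gw : measurable_fun (`]0, w[ : set R) g.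
  apply: measurable_funS mg => // x /=.
  by rewrite !in_itv/=; lra.
rewrite /Rintegral -[in RHS]integral_itv_bndo_bndc//; last exact/measurable_EFinP.
rewrite [in RHS]layer_cake//; last first.
  by move=> x /=; rewrite in_itv/= => xw; apply: g01; lra.
congr fine; apply: eq_integral => t _.
have [dg _] := rg; have wgt0 : 0 < w by rewrite lt_neqAle eq_sym w0; lra.
have w1 : w <= 1 by lra.
by rewrite (measure_decr_superlevel _ dg wgt0 w1) (tail_decr_rearr uh _ rg).
Qed.

Lemma integral_powR_decr_rearr h g p : unit_fun h -> is_decr_rearr h g ->
  0 < p ->
  (\int[mu]_(t in I01) (g t `^ p)%:E = \int[mu]_(t in I01) (h t `^ p)%:E)%E.
Proof.
move=> uh rg p0; have ug := unit_fun_decr_rearr uh rg.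
(* Since [f x ^ p > t] exactly when [f x > t ^ (1/p)], the moment is a function of the tail
   alone. *)
have lc f : unit_fun f -> (\int[mu]_(t in I01) (f t `^ p)%:E =
    \int[mu]_(t in I01) (tail f (t `^ p^-1))%:E)%E.
  move=> [mf f01]; rewrite [LHS]layer_cake//.
  - apply: eq_integral => t; rewrite inE/= in_itv/= => t01.
    rewrite -tailE//; congr (mu _); apply/seteqP; split=> x [Ix] /= tx; split=> //=;
      move: Ix; rewrite /= in_itv/= => /f01 fx.
    + have : (t `^ p^-1) < (f x `^ p) `^ p^-1.
        by rewrite gt0_ltr_powR ?invr_gt0 ?nnegrE ?powR_ge0//; lra.
      by rewrite -powRrM mulfV ?gt_eqF// powRr1//; lra.
    + have : (t `^ p^-1) `^ p < f x `^ p.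
        by rewrite gt0_ltr_powR ?nnegrE ?powR_ge0//; lra.
      by rewrite -powRrM mulVf ?gt_eqF// powRr1//; lra.
  - exact: (measurableT_comp (measurable_powR p) mf).
  - move=> x; rewrite /= in_itv/= => /f01 fx; rewrite powR_ge0/=.
    have := @ge0_ler_powR R p (ltW p0) (f x) 1.
    by rewrite !nnegrE powR1 /=; apply; lra.
rewrite !lc//; apply: eq_integral => t _.
by rewrite (tail_decr_rearr uh _ rg).
Qed.

Lemma integral_tail h : unit_fun h ->
  (\int[mu]_(t in I01) (tail h t)%:E = \int[mu]_(t in I01) (h t)%:E)%E.
Proof.
move=> [mh h01]; rewrite [RHS]layer_cake//.
by apply: eq_integral => t _; rewrite -tailE.
Qed.

Lemma unit_fun_d2z C u : regular C -> unit_fun (fun t => d2z C (u, t)).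
Proof.
move=> rC; split=> [|x _]; last exact: d2z_itv.
apply: measurable_funTS; apply: measurable_fun_pair2; exact: measurable_d2z.
Qed.

(** The sections of [Pi] have constant derivative [v], and the endpoints, where [d2] and [d2z] may
    differ, form a null set. *)
Lemma TT_d2z C u v : regular C -> 0 <= u <= 1 ->
  TT C u v = \int[mu]_(t in I01) Num.min (d2z C (u, t)) v.
Proof.
move=> rC u01; rewrite /TT /upper_prod /Rintegral.
under eq_integral do rewrite d2_Pi.
have E t : I01 t -> Num.min (d2 C u t) v = Num.min (d2z C (u, t)) v.
  by rewrite /d2z/= in_itv/= u01 => ->.
have m : measurable_fun I01 (fun t => (Num.min (d2 C u t) v)%:E).
  apply/measurable_EFinP.
  apply: (eq_measurable_fun (fun t => Num.min (d2z C (u, t)) v)).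
    by move=> t; rewrite inE => /E.
  by apply: measurable_minr => //; exact: (unit_fun_d2z u rC).1.
rewrite integral_itv_bndoo//; congr fine.
by apply: eq_integral => t; rewrite inE => /E ->.
Qed.

Lemma integrable_min h v : unit_fun h -> 0 <= v <= 1 ->
  mu.-integrable I01 (EFin \o (fun t => Num.min (h t) v)).
Proof.
move=> [mh h01] v01; apply: integrable_unit => //.
- by rewrite lebesgue_I01 ltry.
- exact: measurable_minr.
- by move=> x; rewrite /= in_itv/= => /h01; rewrite /Num.min; case: ifPn; lra.
Qed.

(** The Lipschitz bounds hold pointwise, as [min(x, w) - min(x, v)] lies between 0 and [w - v];
    measurability in [u] comes from Tonelli. *)
Lemma regular_TT C : regular C -> regular (TT C).
Proof.
move=> rC; split=> [u v w u01 v0 vw w1|v v01].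
  have uh := unit_fun_d2z u rC.
  rewrite !TT_d2z// -RintegralB//; try by apply: integrable_min => //; lra.
  have I := integrable_min uh.
  have b t : 0 <= Num.min (d2z C (u, t)) w - Num.min (d2z C (u, t)) v <= w - v.
    by rewrite /Num.min; do 2?case: ifPn; lra.
  apply/andP; split; first by apply: Rintegral_ge0 => t _; have := b t; lra.
  have -> : w - v = \int[mu]_(t in I01) cst (w - v) t.
    by rewrite Rintegral_cst// [X in fine X]lebesgue_I01 mulr1.
  apply: le_Rintegral => //.
  - rewrite (_ : EFin \o _ = ((EFin \o (fun t => Num.min (d2z C (u, t)) w)) \-
      (EFin \o (fun t => Num.min (d2z C (u, t)) v)))%E)//.
    by apply: integrableB => //; apply: I; lra.
  - apply: integrable_unit => //; [by rewrite lebesgue_I01 ltry| by move=> x _ /=; lra].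
  - by move=> t _; have /andP[_] := b t.
(* The integral may run over the whole line: [d2z] vanishes off [(0,1)] and [v >= 0], so the
   integrand is zero there. *)
apply: (eq_measurable_fun (fun u => \int[mu]_t Num.min (d2z C (u, t)) v)).
  move=> u; rewrite inE/= in_itv/= => u01; rewrite TT_d2z// [RHS]Rintegral_mkcond.
  apply: eq_Rintegral => t _; rewrite patchE; case: ifPn => //.
  rewrite notin_setE/= in_itv/= /d2z/= => /negP/negbTE ->.
  by rewrite andbF min_l//; lra.
apply: measurable_funTS; apply: measurableT_comp => //.
pose f (p : R * measurableTypeR R) : \bar R := (Num.min (d2z C p) v)%:E.
apply: (@measurable_fun_fubini_tonelli_F _ _ _ _ R mu f) => [|p].
  apply/measurable_EFinP; apply: measurable_minr => //.
  exact: measurable_d2z.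
by rewrite lee_fin le_min; have := d2z_itv p rC; lra.
Qed.

End UpperProduct.

(** * Iterates and norms *)

Section Iterates.
Variable R : realType.
Local Notation mu := (@lebesgue_measure R).
Local Notation I01 := (`]0, 1[%classic : set R).
Implicit Types (C D : R -> R -> R) (g h : R -> R) (p u v w t : R).

Lemma eq_integral_ae01 (f g : R -> \bar R) : measurable_fun I01 f ->
  measurable_fun I01 g -> {ae mu, forall t, 0 < t < 1 -> f t = g t} ->
  (\int[mu]_(t in I01) f t = \int[mu]_(t in I01) g t)%E.
Proof.
move=> mf mg fg; apply: ae_eq_integral => //; exact: filterS fg.
Qed.

Lemma Rintegral_min_ae f g v : unit_fun f -> unit_fun g ->
  {ae mu, forall t, 0 < t < 1 -> f t = g t} ->
  \int[mu]_(t in I01) Num.min (f t) v = \int[mu]_(t in I01) Num.min (g t) v.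
Proof.
move=> [mf _] [mg _] fg; congr fine; apply: eq_integral_ae01.
- by apply/measurable_EFinP; exact: measurable_minr.
- by apply/measurable_EFinP; exact: measurable_minr.
- apply: filterS fg; first exact: (ae_filter_ringOfSetsType mu).
  by move=> t /= H t01; rewrite H.
Qed.

Lemma d2z_ae C g u : 0 <= u <= 1 -> unit_fun g ->
  (forall w, 0 <= w <= 1 -> C u w = \int[mu]_(t in `]0, w]) g t) ->
  {ae mu, forall t, 0 < t < 1 -> d2z C (u, t) = g t}.
Proof.
move=> u01 [mg g01] CE; have := derive1_Rintegral_ae mg g01 CE.
apply: filterS; first exact: (ae_filter_ringOfSetsType mu).
by move=> t /= H t01; rewrite /d2z/= u01 t01 /d2 H.
Qed.

Section Fixed.
Variables (C : R -> R -> R) (u : R).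
Hypotheses (rC : regular C) (u01 : 0 <= u <= 1).
Local Notation h := (fun t => d2z C (u, t)).

Let uh : unit_fun h := unit_fun_d2z u rC.

Lemma TT_tail v : 0 <= v <= 1 -> TT C u v = \int[mu]_(t in `]0, v]) tail h t.
Proof. by move=> v01; rewrite TT_d2z// Rintegral_tail_min. Qed.

Lemma d2z_TT_ae :
  {ae mu, forall t, 0 < t < 1 -> d2z (TT C) (u, t) = tail h t}.
Proof.
apply: d2z_ae => //; first exact: unit_fun_tail uh.1.
exact: TT_tail.
Qed.

Variable g : R -> R.
Hypothesis rg : is_decr_rearr h g.

Lemma TT2_decr_rearr w : 0 <= w <= 1 ->
  TT (TT C) u w = \int[mu]_(t in `]0, w]) g t.
Proof.
move=> w01; rewrite TT_d2z//; last exact: regular_TT.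
rewrite -(Rintegral_min_tail uh rg w01); apply: Rintegral_min_ae.
- exact/unit_fun_d2z/regular_TT.
- exact: unit_fun_tail uh.1.
- exact: d2z_TT_ae.
Qed.

Lemma d2z_TT2_ae :
  {ae mu, forall t, 0 < t < 1 -> d2z (TT (TT C)) (u, t) = g t}.
Proof.
apply: d2z_ae => //; first exact: unit_fun_decr_rearr rg.
exact: TT2_decr_rearr.
Qed.

Lemma TT3 v : 0 <= v <= 1 -> TT (TT (TT C)) u v = TT C u v.
Proof.
move=> v01; rewrite TT_d2z//; last exact/regular_TT/regular_TT.
have ug := unit_fun_decr_rearr uh rg.
(* The derivative of the second iterate is [g] almost everywhere, and only its tail matters, which
   is that of [h]. *)
rewrite (@Rintegral_min_ae _ g)//.
- rewrite Rintegral_tail_min// TT_tail//.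
  by apply: eq_Rintegral => t _; rewrite (tail_decr_rearr uh _ rg).
- exact/unit_fun_d2z/regular_TT/regular_TT.
- exact: d2z_TT2_ae.
Qed.

Lemma Dup_decr_rearr w : 0 <= w <= 1 ->
  Dup C u w = \int[mu]_(t in `]0, w]) decr_rearr h t.
Proof.
move=> w01; rewrite /Dup; have -> : decr_rearr (d2 C u) = decr_rearr h.
  (* The predicate sees its function only on [(0,1)], where [d2] and [d2z] agree; equal predicates
     make [xget] choose the same rearrangement. *)
  rewrite /decr_rearr; congr (xget _ _); apply/funext => f; apply/propext.
  rewrite /is_decr_rearr.
  have E y : [set t | 0 < t < 1 /\ d2 C u t <= y] =
             [set t | 0 < t < 1 /\ d2z C (u, t) <= y].
    by apply/seteqP; split=> t /= [t01]; rewrite /d2z/= u01 t01.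
  by split=> -[df ef]; split=> // y; rewrite ef E.
have [mr r01] := unit_fun_decr_rearr uh (decr_rearrP uh).
rewrite /Rintegral -integral_itv_obnd_cbnd//; apply/measurable_EFinP.
(* Measurability is known on the open interval only, so the endpoint [w = 1] is added separately. *)
have [w1|w1] := eqVneq w 1.
  rewrite w1; apply/measurable_fun_itv_bndo_bndcP.
  exact: mr.
apply: measurable_funS mr => // x /=; rewrite !in_itv/=.
have : w < 1 by rewrite lt_neqAle w1; lra.
lra.
Qed.

End Fixed.

(** Identities such as [TT3] hold on the unit square only. This suffices to iterate them, since the
    extensions then coincide and determine the derivatives at interior points. *)
Lemma TT_congr C D : regular C -> regular D ->
  (forall u v, 0 <= u <= 1 -> 0 <= v <= 1 -> C u v = D u v) ->
  forall u v, 0 <= u <= 1 -> 0 <= v <= 1 -> TT C u v = TT D u v.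
Proof.
move=> rC rD CD u v u01 v01; rewrite (TT_d2z _ rC u01) (TT_d2z _ rD u01).
have CDu : extend C u = extend D u.
  by apply/funext => x; apply: CD; exact: clamp01_itv.
apply: eq_Rintegral => t; rewrite inE/= in_itv/= => t01.
rewrite /d2z/= u01 t01/=.
by rewrite (d2_extend C u01 t01) (d2_extend D u01 t01) CDu.
Qed.

Lemma regular_iter C n : regular C -> regular (iter n (@TT R) C).
Proof. by move=> rC; elim: n => //= n IH; exact: regular_TT. Qed.

(** Period two sets in after one application of [TT], hence the [n.+1]; [TT3] is the base case and
    [TT_congr] propagates it. *)
Lemma iter_TT_add2 C n u v : regular C -> 0 <= u <= 1 -> 0 <= v <= 1 ->
  iter n.+3 (@TT R) C u v = iter n.+1 (@TT R) C u v.
Proof.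
move=> rC; elim: n u v => [|n IH] u v u01 v01.
  rewrite /=; exact: (TT3 rC u01 (decr_rearrP (unit_fun_d2z u rC)) v01).
rewrite [in LHS]iterS [in RHS]iterS.
exact: (TT_congr (regular_iter n.+3 rC) (regular_iter n.+1 rC) IH u01 v01).
Qed.

Lemma iter_TT_double C n k u v : regular C -> 0 <= u <= 1 -> 0 <= v <= 1 ->
  iter (2 * k + n.+1) (@TT R) C u v = iter n.+1 (@TT R) C u v.
Proof.
move=> rC u01 v01; elim: k => [|k IH]; first by rewrite muln0 add0n.
rewrite (_ : (2 * k.+1 + n.+1)%N = (2 * k + n).+3); last first.
  by rewrite mulnS -addnA -addnS add2n addnS.
by rewrite (iter_TT_add2 _ rC u01 v01) -addnS.
Qed.

(** Moves the integral over [v] inside, since tails and rearrangements act on sections at fixed [u].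
    [G] is constrained only for [0 < v < 1], the endpoints being null. *)
Lemma fubini_tonelli_strip (G : R -> \bar R)
    (f : measurableTypeR R * measurableTypeR R -> \bar R) :
  measurable_fun setT f -> (forall x, (0 <= f x)%E) ->
  (forall u v, ~~ (0 < v < 1) -> f (u, v) = 0%E) ->
  (forall v, 0 < v < 1 -> (G v = \int[mu]_u f (u, v))%E) ->
  (\int[mu]_(v in `[0%R, 1%R]) G v = \int[mu]_u \int[mu]_(v in I01) f (u, v))%E.
Proof.
move=> mf f0 f1 Gf.
have IE v : (v \in I01) = (0 < v < 1) by apply/idP/idP; rewrite inE/= in_itv.
have mG : measurable_fun setT (fun v => \int[mu]_u f (u, v))%E.
  exact: (@measurable_fun_fubini_tonelli_G _ _ _ _ R mu f).
rewrite integral_itv_bndoo; last first.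
  apply: (eq_measurable_fun (fun v => \int[mu]_u f (u, v))%E).
    by move=> v; rewrite IE => /Gf.
  exact: measurable_funTS.
have -> : (\int[mu]_(v in I01) G v = \int[mu]_v \int[mu]_u f (u, v))%E.
  rewrite integral_mkcond; apply: eq_integral => v _; rewrite patchE IE.
  case: ifPn => [/Gf//|v01].
  by rewrite integral0_eq// => u _; exact: f1.
rewrite -(@fubini_tonelli _ _ _ _ R mu mu f mf f0); apply: eq_integral => u _.
rewrite [RHS]integral_mkcond; apply: eq_integral => v _; rewrite patchE IE.
by case: ifPn => // v01; exact: f1.
Qed.

Lemma integral_powR_d2 p C : regular C -> 0 < p ->
  (\int[mu]_(v in `[0%R, 1%R]) \int[mu]_(u in `[0%R, 1%R]) (`|d2 C u v| `^ p)%:E =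
   \int[mu]_u \int[mu]_(t in I01) (d2z C (u, t) `^ p)%:E)%E.
Proof.
move=> rC p0; have pn0 : p != 0 by rewrite gt_eqF.
apply: (@fubini_tonelli_strip _ (fun x => (d2z C x `^ p)%:E)).
- apply/measurable_EFinP; apply: (measurableT_comp (measurable_powR p)).
  exact: measurable_d2z.
- by move=> x; rewrite lee_fin powR_ge0.
(* Here [p != 0] matters: [0 ^ p] must be 0 for the zero extension to contribute nothing. *)
- by move=> u v /negbTE v01; rewrite /d2z/= v01 andbF powR0.
move=> v v01; rewrite integral_mkcond; apply: eq_integral => u _.
have uE : (u \in (`[0, 1]%classic : set R)) = (0 <= u <= 1).
  by apply/idP/idP; rewrite inE/= in_itv.
have := d2z_itv (u, v) rC; rewrite patchE uE /d2z/= v01 andbT.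
case: ifPn => [_ /andP[d0 _]|_ _]; first by rewrite ger0_norm.
by rewrite powR0.
Qed.

Lemma norm_d2E p C : regular C -> 0 < p -> norm_d2 p C =
  poweR (\int[mu]_u \int[mu]_(t in I01) (d2z C (u, t) `^ p)%:E)%E p^-1.
Proof.
by move=> rC p0; exact: (congr1 (fun x => poweR x p^-1) (integral_powR_d2 rC p0)).
Qed.

Lemma eq_norm_d2 p C D : regular C -> regular D -> 0 < p ->
  (forall u, 0 <= u <= 1 -> (\int[mu]_(t in I01) (d2z C (u, t) `^ p)%:E =
                             \int[mu]_(t in I01) (d2z D (u, t) `^ p)%:E)%E) ->
  norm_d2 p C = norm_d2 p D.
Proof.
move=> rC rD p0 CD; rewrite (norm_d2E rC p0) (norm_d2E rD p0).
apply: (congr1 (fun x => poweR x p^-1)); apply: eq_integral => u _.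
have [u01|u01] := boolP (0 <= u <= 1); first exact: CD.
by apply: eq_integral => t _; rewrite /d2z/= (negbTE u01).
Qed.

Lemma integral_powR_ae p f g : unit_fun f -> unit_fun g ->
  {ae mu, forall t, 0 < t < 1 -> f t = g t} ->
  (\int[mu]_(t in I01) (f t `^ p)%:E = \int[mu]_(t in I01) (g t `^ p)%:E)%E.
Proof.
move=> [mf _] [mg _] fg; apply: eq_integral_ae01.
- by apply/measurable_EFinP; exact: (measurableT_comp (measurable_powR p)).
- by apply/measurable_EFinP; exact: (measurableT_comp (measurable_powR p)).
- apply: filterS fg; first exact: (ae_filter_ringOfSetsType mu).
  by move=> t /= H t01; rewrite H.
Qed.

Lemma integral_powR1 f : (forall t, 0 <= f t <= 1) ->
  (\int[mu]_(t in I01) (f t `^ 1)%:E = \int[mu]_(t in I01) (f t)%:E)%E.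
Proof.
move=> f01; apply: eq_integral => t _; rewrite powRr1//.
by have /andP[] := f01 t.
Qed.

(** One application of [TT] replaces each section derivative by its tail, which has the same
    integral; this is why the exponent is 1. *)
Lemma norm_d2_TT C : regular C -> norm_d2 1 (TT C) = norm_d2 1 C.
Proof.
move=> rC; have rT := regular_TT rC.
apply: (eq_norm_d2 rT rC ltr01) => u u01; have uh := unit_fun_d2z u rC.
apply: etrans (integral_powR_ae 1 (unit_fun_d2z u rT) (unit_fun_tail uh.1)
  (d2z_TT_ae rC u01)) _.
apply: etrans (integral_powR1 (fun t => tail_itv t uh.1)) _.
apply: etrans (integral_tail uh) _.
exact: esym (integral_powR1 (fun t => d2z_itv (u, t) rC)).
Qed.

Lemma norm_d2_TT2 p C : regular C -> 0 < p ->
  norm_d2 p (TT (TT C)) = norm_d2 p C.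
Proof.
move=> rC p0; have rT := regular_TT (regular_TT rC).
apply: (eq_norm_d2 rT rC p0) => u u01.
have uh := unit_fun_d2z u rC; have rg := decr_rearrP uh.
apply: etrans (integral_powR_ae p (unit_fun_d2z u rT) (unit_fun_decr_rearr uh rg)
  (d2z_TT2_ae rC u01 rg)) _.
exact: integral_powR_decr_rearr uh rg p0.
Qed.

End Iterates.

Theorem mainTheorem9 (R : realType) (D : R -> R -> R) (hD : is_copula D) :
  [/\ (forall k : nat, (1 <= k)%N -> forall u v : R, 0 <= u <= 1 -> 0 <= v <= 1 ->
          iter (2 * k) (@TT R) D u v = Dup D u v),
      (forall k : nat, (1 <= k)%N -> forall u v : R, 0 <= u <= 1 -> 0 <= v <= 1 ->
          iter (2 * k + 1) (@TT R) D u v = TT D u v),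
      norm_d2 1 (TT D) = norm_d2 1 D
    & forall p : R, 1 <= p -> norm_d2 p (iter 2 (@TT R) D) = norm_d2 p D].
Proof.
have rD := copula_regular hD; split.
- move=> [//|k] _ u v u01 v01.
  (* Writing the exponent as [2 * k + 2] reduces to the second iterate, which integrates any
     decreasing rearrangement, in particular the one chosen in [Dup]. *)
  rewrite mulnS addnC (iter_TT_double 1 k rD u01 v01).
  rewrite (Dup_decr_rearr rD u01 v01) /=.
  exact: (TT2_decr_rearr rD u01 (decr_rearrP (unit_fun_d2z u rD)) v01).
- by move=> k _ u v u01 v01; rewrite (iter_TT_double 0 k rD u01 v01).
- exact: norm_d2_TT rD.
- by move=> p p1; exact: norm_d2_TT2 rD (lt_le_trans ltr01 p1).
Qed.
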